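(* Let $D$ be a finitely generated free abelian group and let $A=\bigoplus_{d\in D}A_d$ be a $D$-graded integral domain generated by homogeneous elements $x_1,\dots,x_r$ over $A_0$. Assume that $A_0$ is a field and $A^\times=A_0^\times$. Let $X=\operatorname{Proj}_{\mathrm{MH}}A$. For a relevant element $f\in A$ let $D_f$ be the subgroup of $D$ generated by $\{\deg a : a\in A \text{ homogeneous},\ a \text{ divides } f^N \text{ for some } N>0\}$. Let $d\in D$ be such that $d\in D_f$ for every relevant element $f\in A$. Then $\mathcal{O}_X(d)$ is a line bundle.
   Context: All rings are commutative with $1$. Let $D$ be a finitely generated abelian group. A $D$-graded ring $B$ is periodic if the subgroup $\{d\in D : \exists\, g\in B_d\cap B^\times\}$ has finite index in $D$. A homogeneous element $f$ of a $D$-graded ring $A$ is relevant if the localization $A_f$ (with its induced $D$-grading) is periodic; $A_{(f)}$ denotes the degree $0$ part of $A_f$. The grading corresponds to an action of the diagonalizable group scheme $\operatorname{Spec}A_0[D]$ on $\operatorname{Spec}A$; let $Q$ be the quotient in the category of ringed spaces. For relevant $f$ one has an open subspace $D_+(f)=\operatorname{Spec}A_{(f)}\subset Q$, and $\operatorname{Proj}_{\mathrm{MH}}A=\bigcup_{f\text{ relevant}}D_+(f)\subset Q$, which is a scheme. Twisted sheaves. A point $p\in X=\operatorname{Proj}_{\mathrm{MH}}A$ corresponds to a homogeneous ideal $I_p\subset A$ (not necessarily prime) such that the homogeneous elements of $A\setminus I_p$ form a multiplicatively closed set. For a $D$-graded $A$-module $M$, let $M_{(I_p)}$ be the degree $0$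 part of the localization of $M$ at this multiplicative set. The sheaf $\widetilde{M}$ on $X$ assigns to an open $U$ the module of sections $s:U\to\coprod_{p\in U}M_{(I_p)}$ that are locally given by a single element $m/a$ with $m\in M$ and $a\in A$ not in any of the ideals $I_p$ involved; equivalently, $\widetilde{M}$ restricted to $D_+(f)=\operatorname{Spec}A_{(f)}$ is the quasi-coherent sheaf associated to $M_{(f)}$, the degree $0$ part of $M_f$. For $e\in D$, $M(e)$ denotes the module $M$ with grading $M(e)_d=M_{d+e}$, and $\mathcal{O}_X(d):=\widetilde{A(d)}$. *)

(* Defs.v *)
From HB Require Import structures.
From mathcomp Require Import all_boot all_order all_algebra.
From mathcomp Require Import generic_quotient ring_quotient.
From mathcomp Require Import all_classical topology.
From mathcomp Require Import ring.

Set Implicit Arguments.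
Unset Strict Implicit.
Unset Printing Implicit Defensive.

Import GRing.Theory.
Local Open Scope classical_set_scope.
Local Open Scope ring_scope.
Local Open Scope quotient_scope.

Definition free_fg (D : zmodType) : Prop :=
  exists (n : nat) (b : 'I_n -> D),
    forall d, exists! c : {ffun 'I_n -> int}, d = \sum_i b i *~ c i.

Definition gen_subgroup (D : zmodType) (E : set D) : set D :=
  [set d | forall H : {pred D}, zmod_closed H ->
             (forall e, E e -> e \in H) -> d \in H].

Definition finite_index (D : zmodType) (H : set D) : Prop :=
  exists s : seq D, forall d, exists2 e, e \in s & H (d - e).

Definition decomposition (D V : zmodType) (G : D -> {pred V}) (v : V)
    (c : D -> V) : Prop :=
  [/\ forall d, c d \in G d, finite_set [set d | c d != 0]
    & v = \sum_(d \in [set: D]) c d].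

Record gradation (D V : zmodType) := Gradation {
  gpart :> D -> {pred V};
  gpart_zmod : forall d, zmod_closed (gpart d);
  gpart_decomp : forall v, exists! c, decomposition gpart v c }.

Record graded_ring (D : zmodType) (A : comPzRingType) := GradedRing {
  gring_grad :> gradation D A;
  gring1 : 1 \in gring_grad 0;
  gringM : forall d e a b,
    a \in gring_grad d -> b \in gring_grad e -> a * b \in gring_grad (d + e) }.

Record graded_module (D : zmodType) (A : comPzRingType) (gA : graded_ring D A)
    (M : lmodType A) := GradedModule {
  gmod_grad :> gradation D M;
  gmodZ : forall d e a m,
    a \in gA d -> m \in gmod_grad e -> a *: m \in gmod_grad (d + e) }.

Definition homogeneous (D V : zmodType) (G : gradation D V) : {pred V} :=
  [pred v | `[< exists d, v \in G d >]].

Section Shift.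
Variables (D : zmodType) (A : comPzRingType) (gA : graded_ring D A).

Definition regular_module : graded_module gA A^o :=
  @GradedModule D A gA A^o gA (@gringM D A gA).

Variables (M : lmodType A) (gM : graded_module gA M) (e : D).

Definition shift_part : D -> {pred M} := fun d => gM (d + e).

Lemma decomposition_shift v c :
  decomposition gM v c -> decomposition shift_part v (fun d => c (d + e)).
Proof.
move=> [cG cfin ->]; split=> [d||]; first exact: cG.
  rewrite (_ : [set d | _] = (fun d => d - e) @` [set d | c d != 0]).
    exact: finite_image.
  apply/seteqP; split=> [d /= cd|_ [d /= cd <-]]; last by rewrite subrK.
  by exists (d + e) => //; rewrite addrK.
rewrite (@reindex_fsbigT _ _ _ _ _ (fun d => d + e)) //.
exists (fun d => d - e) => d; [exact: addrK | exact: subrK].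
Qed.

Lemma decomposition_unshift v c :
  decomposition shift_part v c -> decomposition gM v (fun d => c (d - e)).
Proof.
move=> [cG cfin ->]; split=> [d||].
- by have := cG (d - e); rewrite /shift_part subrK.
- rewrite (_ : [set d | _] = (fun d => d + e) @` [set d | c d != 0]).
    exact: finite_image.
  apply/seteqP; split=> [d /= cd|_ [d /= cd <-]]; last by rewrite addrK.
  by exists (d - e) => //; rewrite subrK.
rewrite (@reindex_fsbigT _ _ _ _ _ (fun d => d - e)) //.
exists (fun d => d + e) => d; [exact: subrK | exact: addrK].
Qed.

Lemma shift_decomp v : exists! c, decomposition shift_part v c.
Proof.
have [c [cP cU]] := gpart_decomp gM v.
exists (fun d => c (d + e)); split; first exact: decomposition_shift.
move=> c' /decomposition_unshift/cU -> .
by apply/funext => d; rewrite addrK.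
Qed.

Definition shift_gradation : gradation D M :=
  @Gradation D M shift_part (fun d => gpart_zmod gM (d + e)) shift_decomp.

Lemma shiftZ d d' a m :
  a \in gA d -> m \in shift_gradation d' -> a *: m \in shift_gradation (d + d').
Proof.
by move=> ad md; have := gmodZ ad md; rewrite addrA.
Qed.

Definition shift_module : graded_module gA M := GradedModule shiftZ.

End Shift.

Section Localization.
Variables (A : comPzRingType) (S : mulrClosed A) (M : lmodType A).

Definition loc_rel : rel (M * {s : A | s \in S}) := fun x y =>
  `[< exists2 u, u \in S & u *: (val y.2 *: x.1) = u *: (val x.2 *: y.1) >].

Lemma loc_rel_equiv : equiv_class_of loc_rel.
Proof.
split=> [x|x y|y x z].
- by apply/asboolP; exists 1; rewrite ?rpred1.
- by apply/asboolP/asboolP => -[u uS e]; exists u.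
- move=> /asboolP[u uS e] /asboolP[v vS f]; apply/asboolP.
  exists (u * v * val y.2); first by rewrite !rpredM ?(valP y.2).
  move: e f; rewrite !scalerA => e f.
  have -> : u * v * val y.2 * val z.2 = (v * val z.2) * (u * val y.2) by ring.
  rewrite -scalerA e scalerA.
  have -> : v * val z.2 * (u * val x.2) = (u * val x.2) * (v * val z.2) by ring.
  by rewrite -scalerA f scalerA; congr (_ *: _); ring.
Qed.

Canonical loc_equiv := EquivRelPack loc_rel_equiv.

Definition loc : Type := {eq_quot loc_rel}.
HB.instance Definition _ := Choice.on loc.

Definition loc_frac (m : M) (s : A) (sS : s \in S) : loc :=
  \pi_({eq_quot loc_rel}) (m, exist _ s sS).

Lemma frac_eq m s (sS : s \in S) n t (tS : t \in S) :
  loc_frac m sS = loc_frac n tS <->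
  exists2 u, u \in S & (u * t) *: m = (u * s) *: n.
Proof.
split=> [/eqmodP/asboolP[u uS /= e]|[u uS e]].
  by exists u; rewrite // -!scalerA.
by apply/eqmodP/asboolP; exists u; rewrite //= !scalerA.
Qed.

Lemma frac_repr (x : loc) : loc_frac (repr x).1 (valP (repr x).2) = x.
Proof.
rewrite -[RHS]reprK /loc_frac; congr (\pi_({eq_quot loc_rel}) _).
by case: (repr x) => m u; congr (_, _); apply: val_inj.
Qed.

Lemma frac_surj (x : loc) : exists m s (sS : s \in S), x = loc_frac m sS.
Proof.
by exists (repr x).1, (val (repr x).2), (valP (repr x).2); rewrite frac_repr.
Qed.

Definition loc_add (x y : loc) : loc :=
  loc_frac (val (repr y).2 *: (repr x).1 + val (repr x).2 *: (repr y).1)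
       (rpredM (valP (repr x).2) (valP (repr y).2)).

Definition loc_opp (x : loc) : loc := loc_frac (- (repr x).1) (valP (repr x).2).

Lemma repr_frac m s (sS : s \in S) :
  exists2 u, u \in S &
    (u * s) *: (repr (loc_frac m sS)).1 = (u * val (repr (loc_frac m sS)).2) *: m.
Proof. by have /frac_eq := frac_repr (loc_frac m sS). Qed.

Lemma loc_addE m s (sS : s \in S) n t (tS : t \in S) :
  loc_add (loc_frac m sS) (loc_frac n tS) = loc_frac (t *: m + s *: n) (rpredM sS tS).
Proof.
rewrite /loc_add; have [u uS] := repr_frac m sS; have [v vS] := repr_frac n tS.
set x := repr (loc_frac m sS); set y := repr (loc_frac n tS) => ey ex.
apply/frac_eq; exists (u * v); first exact: rpredM.
rewrite !scalerDr !scalerA; congr (_ + _).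
  have -> : u * v * (s * t) * val y.2 = v * t * val y.2 * (u * s) by ring.
  by rewrite -scalerA ex scalerA; congr (_ *: _); ring.
have -> : u * v * (s * t) * val x.2 = u * s * val x.2 * (v * t) by ring.
by rewrite -scalerA ey scalerA; congr (_ *: _); ring.
Qed.

Lemma loc_oppE m s (sS : s \in S) : loc_opp (loc_frac m sS) = loc_frac (- m) sS.
Proof.
rewrite /loc_opp; have [u uS e] := repr_frac m sS.
by apply/frac_eq; exists u; rewrite // !scalerN e.
Qed.

Lemma frac_congr m s (sS : s \in S) n t (tS : t \in S) :
  m = n -> s = t -> loc_frac m sS = loc_frac n tS.
Proof. by move=> -> est; case: _ / est in tS *; rewrite (bool_irrelevance sS tS). Qed.

Lemma loc_addA : associative loc_add.
Proof.
move=> x y z; have [m [s [sS ->]]] := frac_surj x.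
have [n [t [tS ->]]] := frac_surj y; have [p [r [rS ->]]] := frac_surj z.
rewrite !loc_addE; apply: frac_congr; last by ring.
by rewrite !scalerDr !scalerA !addrA; do ![congr (_ + _)]; congr (_ *: _); ring.
Qed.

Lemma loc_addC : commutative loc_add.
Proof.
move=> x y; have [m [s [sS ->]]] := frac_surj x.
have [n [t [tS ->]]] := frac_surj y.
by rewrite !loc_addE; apply: frac_congr; [rewrite addrC | ring].
Qed.

Lemma loc_add0 : left_id (loc_frac 0 (rpred1 S)) loc_add.
Proof.
move=> x; have [m [s [sS ->]]] := frac_surj x.
by rewrite loc_addE; apply: frac_congr; rewrite ?mul1r // scaler0 add0r scale1r.
Qed.

Lemma loc_addN : left_inverse (loc_frac 0 (rpred1 S)) loc_opp loc_add.
Proof.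
move=> x; have [m [s [sS ->]]] := frac_surj x.
rewrite loc_oppE loc_addE; apply/frac_eq; exists 1; first exact: rpred1.
by rewrite scalerN addNr !scaler0.
Qed.

HB.instance Definition _ :=
  GRing.isZmodule.Build loc loc_addA loc_addC loc_add0 loc_addN.

Lemma fracD m s (sS : s \in S) n t (tS : t \in S) :
  loc_frac m sS + loc_frac n tS = loc_frac (t *: m + s *: n) (rpredM sS tS).
Proof. exact: loc_addE. Qed.

Lemma fracN m s (sS : s \in S) : - loc_frac m sS = loc_frac (- m) sS.
Proof. exact: loc_oppE. Qed.

Lemma frac0 s (sS : s \in S) : loc_frac 0 sS = 0.
Proof. by apply/frac_eq; exists 1; rewrite ?rpred1 // !scaler0. Qed.

End Localization.

Section LocalizationModule.
Variables (A : comPzRingType) (S : mulrClosed A) (M : lmodType A).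
Local Notation locR := (loc S A^o).

Definition loc_scale (x : locR) (y : loc S M) : loc S M :=
  loc_frac (((repr x).1 : A) *: (repr y).1)
       (rpredM (valP (repr x).2) (valP (repr y).2)).

Lemma loc_scaleE (a : A) s (sS : s \in S) m t (tS : t \in S) :
  loc_scale (loc_frac (a : A^o) sS) (loc_frac m tS) = loc_frac (a *: m) (rpredM sS tS).
Proof.
rewrite /loc_scale; have [u uS] := repr_frac (a : A^o) sS.
have [v vS] := repr_frac m tS.
set x := repr (loc_frac (a : A^o) sS); set y := repr (loc_frac m tS) => ey ex.
apply/frac_eq; exists (u * v); first exact: rpredM.
rewrite !scalerA.
have -> : u * v * (s * t) * (x.1 : A) = (u * s * (x.1 : A)) * (v * t) by ring.
have -> : u * s * (x.1 : A) = u * val x.2 * a by exact: ex.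
by rewrite -scalerA ey scalerA; congr (_ *: _); ring.
Qed.

End LocalizationModule.

Section LocalizationRing.
Variables (A : comPzRingType) (S : mulrClosed A).
Local Notation locR := (loc S A^o).

Definition loc_one : locR := loc_frac (1 : A^o) (rpred1 S).
Definition loc_mul : locR -> locR -> locR := @loc_scale A S A^o.

Lemma loc_mulE (a : A) s (sS : s \in S) (b : A) t (tS : t \in S) :
  loc_mul (loc_frac (a : A^o) sS) (loc_frac (b : A^o) tS) =
  loc_frac (a * b : A^o) (rpredM sS tS).
Proof. exact: loc_scaleE. Qed.

Lemma loc_mulA : associative loc_mul.
Proof.
move=> x y z; have [m [s [sS ->]]] := frac_surj x.
have [n [t [tS ->]]] := frac_surj y; have [p [r [rS ->]]] := frac_surj z.
rewrite (loc_mulE n tS p rS) (loc_mulE m sS n tS) (loc_mulE m sS _ _).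
rewrite (loc_mulE _ _ p rS).
by apply: frac_congr; exact: mulrA.
Qed.

Lemma loc_mulC : commutative loc_mul.
Proof.
move=> x y; have [m [s [sS ->]]] := frac_surj x.
have [n [t [tS ->]]] := frac_surj y.
by rewrite !loc_mulE; apply: frac_congr; exact: mulrC.
Qed.

Lemma loc_mul1 : left_id loc_one loc_mul.
Proof.
move=> x; have [m [s [sS ->]]] := frac_surj x.
by rewrite loc_mulE; apply: frac_congr; exact: mul1r.
Qed.

Lemma loc_mulD : left_distributive loc_mul +%R.
Proof.
move=> x y z; have [m [s [sS ->]]] := frac_surj x.
have [n [t [tS ->]]] := frac_surj y; have [p [r [rS ->]]] := frac_surj z.
rewrite fracD !loc_mulE fracD; apply/frac_eq; exists 1; first exact: rpred1.
change (1 * (s * r * (t * r)) * ((t * (m : A) + s * (n : A)) * (p : A)) =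
  1 * (s * t * r) * (t * r * ((m : A) * (p : A)) + s * r * ((n : A) * (p : A)))).
by ring.
Qed.

HB.instance Definition _ := GRing.Zmodule_isComPzRing.Build locR
  loc_mulA loc_mulC loc_mul1 loc_mulD.

Lemma fracM (a : A) s (sS : s \in S) (b : A) t (tS : t \in S) :
  loc_frac (a : A^o) sS * loc_frac (b : A^o) tS = loc_frac (a * b : A^o) (rpredM sS tS).
Proof. exact: loc_mulE. Qed.

Variable M : lmodType A.

Lemma loc_scaleA (x y : locR) (z : loc S M) :
  loc_scale x (loc_scale y z) = loc_scale (x * y) z.
Proof.
have [m [s [sS ->]]] := frac_surj x.
have [n [t [tS ->]]] := frac_surj y; have [p [r [rS ->]]] := frac_surj z.
rewrite fracM (@loc_scaleE A S M n _ tS) (@loc_scaleE A S M m _ sS).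
rewrite (@loc_scaleE A S M (m * n)).
by apply: frac_congr; [exact: scalerA | exact: mulrA].
Qed.

Lemma loc_scale1 : left_id (1 : locR) (@loc_scale A S M).
Proof.
move=> x; have [m [s [sS ->]]] := frac_surj x.
by rewrite loc_scaleE; apply: frac_congr; rewrite ?scale1r ?mul1r.
Qed.

Lemma loc_scaleDr : right_distributive (@loc_scale A S M) +%R.
Proof.
move=> x y z; have [m [s [sS ->]]] := frac_surj x.
have [n [t [tS ->]]] := frac_surj y; have [p [r [rS ->]]] := frac_surj z.
rewrite fracD !loc_scaleE fracD; apply/frac_eq.
exists 1; first exact: rpred1.
by rewrite !scalerDr !scalerA; congr (_ *: _ + _ *: _); ring.
Qed.

Lemma loc_scaleDl (z : loc S M) :
  {morph (@loc_scale A S M)^~ z : x y / x + y}.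
Proof.
move=> x y /=; have [m [s [sS ->]]] := frac_surj x.
have [n [t [tS ->]]] := frac_surj y; have [p [r [rS ->]]] := frac_surj z.
rewrite fracD !loc_scaleE fracD; apply/frac_eq.
exists 1; first exact: rpred1.
rewrite !scalerDr !scalerA -scalerDl; congr (_ *: _).
change (1 * (s * r * (t * r)) * (t * (m : A) + s * (n : A)) =
  1 * (s * t * r) * (t * r) * (m : A) + 1 * (s * t * r) * (s * r) * (n : A)).
by ring.
Qed.

HB.instance Definition _ := GRing.Zmodule_isLmodule.Build locR (loc S M)
  loc_scaleA loc_scale1 loc_scaleDr loc_scaleDl.

Lemma fracZ (a : A) s (sS : s \in S) (m : M) t (tS : t \in S) :
  loc_frac (a : A^o) sS *: loc_frac m tS = loc_frac (a *: m) (rpredM sS tS).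
Proof. exact: loc_scaleE. Qed.

End LocalizationRing.

Definition loc_part (D : zmodType) (A : comPzRingType) (gA : graded_ring D A)
    (M : lmodType A) (gM : graded_module gA M) (S : mulrClosed A) (e : D) :
    set (loc S M) :=
  [set x | exists d m s (sS : s \in S),
     [/\ m \in gM (d + e), s \in gA d & x = loc_frac m sS]].
Arguments loc_part {D A gA M} gM S e.

Definition powers (A : comPzRingType) (f : A) : {pred A} :=
  [pred a | `[< exists k, a = f ^+ k >]].

Lemma powers_mulr_closed (A : comPzRingType) (f : A) : mulr_closed (powers f).
Proof.
split=> [|a b /asboolP[k ->] /asboolP[l ->]]; apply/asboolP.
  by exists 0%N; rewrite expr0.
by exists (k + l)%N; rewrite exprD.
Qed.

HB.instance Definition _ (A : comPzRingType) (f : A) :=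
  GRing.isMulClosed.Build A (powers f) (powers_mulr_closed f).

Definition periodic (D : zmodType) (B : comPzRingType) (G : D -> set B) : Prop :=
  finite_index [set d | exists2 g, G d g & exists h, g * h = 1].

Definition relevant (D : zmodType) (A : comPzRingType) (gA : graded_ring D A)
    (f : A) : Prop :=
  f \in homogeneous gA /\ periodic (loc_part (regular_module gA) (powers f)).

(* The degree of 0 is not defined, whence a != 0; this only matters for f = 0,
   which contributes the empty set to the multihomogeneous spectrum. *)
Definition degree_group (D : zmodType) (A : comPzRingType)
    (gA : graded_ring D A) (f : A) : set D :=
  gen_subgroup [set d | exists a, [/\ a != 0, a \in gA d &
    exists N b, (0 < N)%N /\ f ^+ N = a * b]].

Record opens (X : topologicalType) := Opens {
  oset :> set X;
  osetP : open oset }.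

Record is_sheaf (X : topologicalType) (F : opens X -> Type)
    (res : forall U V : opens X, V `<=` U -> F U -> F V) : Prop := IsSheaf {
  res_id : forall (U : opens X) (h : U `<=` U) s, res U U h s = s;
  res_comp : forall (U V W : opens X) (hVU : V `<=` U) (hWV : W `<=` V)
      (hWU : W `<=` U) s, res V W hWV (res U V hVU s) = res U W hWU s;
  sheaf_locality : forall (I : Type) (U : opens X) (V : I -> opens X)
      (hV : forall i, V i `<=` U), U `<=` \bigcup_i V i ->
      forall s t, (forall i, res U (V i) (hV i) s = res U (V i) (hV i) t) ->
      s = t;
  sheaf_gluing : forall (I : Type) (U : opens X) (V : I -> opens X)
      (hV : forall i, V i `<=` U), U `<=` \bigcup_i V i ->
      forall s : forall i, F (V i),
      (forall i j (W : opens X) (hi : W `<=` V i) (hj : W `<=` V j),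
         res (V i) W hi (s i) = res (V j) W hj (s j)) ->
      exists t, forall i, res U (V i) (hV i) t = s i }.

Record ringed_space := RingedSpace {
  space :> topologicalType;
  osec : opens space -> comPzRingType;
  ores : forall U V : opens space, V `<=` U -> {rmorphism osec U -> osec V};
  ores_sheaf : is_sheaf (fun U V h => ores h) }.

Record sheaf_of_modules (X : ringed_space) := SheafOfModules {
  msec :> forall U : opens X, lmodType (osec U);
  mres : forall U V : opens X, V `<=` U -> msec U -> msec V;
  mres_linear : forall (U V : opens X) (h : V `<=` U) (a : osec U)
    (s t : msec U), mres h (a *: s + t) = ores h a *: mres h s + mres h t;
  mres_sheaf : is_sheaf mres }.

Section StructureModule.
Variable X : ringed_space.

Lemma ores_linear (U V : opens X) (h : V `<=` U) (a : osec U)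
    (s t : (osec U)^o) :
  (ores h (a *: s + t : (osec U)^o) : (osec V)^o) =
  ores h a *: (ores h s : (osec V)^o) + ores h t.
Proof. by rewrite rmorphD rmorphM. Qed.

Definition structure_module : sheaf_of_modules X :=
  @SheafOfModules X (fun U => (osec U)^o) (fun U V h s => ores h s)
    ores_linear (ores_sheaf X).

End StructureModule.

Definition iso_on (X : ringed_space) (F G : sheaf_of_modules X) (U : opens X) :
    Prop :=
  exists phi : forall V : opens X, V `<=` U -> F V -> G V,
    [/\ forall (V : opens X) (hV : V `<=` U), linear (phi V hV),
        forall (V : opens X) (hV : V `<=` U), bijective (phi V hV)
      & forall (V W : opens X) (hV : V `<=` U) (hW : W `<=` U) (h : W `<=` V) s,
          phi W hW (mres h s) = mres h (phi V hV s)].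

Definition line_bundle (X : ringed_space) (F : sheaf_of_modules X) : Prop :=
  forall x : X, exists U : opens X, oset U x /\ iso_on (structure_module X) F U.

Section ProjMH.
Variables (D : zmodType) (A : comNzRingType) (gA : graded_ring D A).

(* A point of D_+(f) = Spec A_(f), that is, a prime q of A_(f), is encoded by
   the homogeneous ideal of A whose homogeneous elements are the a with
   a^n / f^k in q for some n > 0 and k. *)
Record proj_point := ProjPoint {
  pideal : A -> bool;
  pideal_ideal : idealr_closed pideal;
  pideal_homogeneous : forall a c,
    decomposition gA a c -> a \in pideal -> forall d, c d \in pideal;
  pideal_mul : forall a b, a \in homogeneous gA -> b \in homogeneous gA ->
    a \notin pideal -> b \notin pideal -> a * b \notin pideal;
  pideal_relevant : exists2 f, relevant gA f & f \notin pideal }.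

HB.instance Definition _ := gen_eqMixin proj_point.
HB.instance Definition _ := gen_choiceMixin proj_point.

Definition Dplus (f : A) : set proj_point := [set p | f \notin pideal p].

Definition Dplus_family : set (set proj_point) :=
  [set U | exists2 f, relevant gA f & U = Dplus f].

(* The D_+(f) with f relevant form a basis of the topology: the basic open
   subset D(g / f^k) of Spec A_(f) is D_+(f g), and f g is again relevant. *)
HB.instance Definition _ := isSubBaseTopological.Build proj_point
  Dplus_family (fun U => U).

Definition away (p : proj_point) : {pred A} :=
  [pred a | (a \in homogeneous gA) && (a \notin pideal p)].

Lemma away_mulr_closed p : mulr_closed (away p).
Proof.
have [_ n1 _] := pideal_ideal p.
split=> [|a b /andP[ha ap] /andP[hb bp]].
  by apply/andP; split=> //; apply/asboolP; exists 0; exact: gring1.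
apply/andP; split; last exact: pideal_mul.
move/asboolP: ha => [d ad]; move/asboolP: hb => [e be].
by apply/asboolP; exists (d + e); exact: gringM.
Qed.

HB.instance Definition _ (p : proj_point) :=
  GRing.isMulClosed.Build A (away p) (away_mulr_closed p).

Section Sections.
Variables (M : lmodType A) (gM : graded_module gA M).

Definition locally_fraction (U : set proj_point)
    (s : forall p, U p -> loc (away p) M) : Prop :=
  forall p, U p -> exists V : opens proj_point, oset V p /\
    exists (hV : V `<=` U) (m : M) (a : A), forall q (Vq : oset V q),
      exists aq : a \in away q, s q (hV q Vq) = loc_frac m aq.

(* The degree 0 part loc_part gM (away p) 0 is the module M_(I_p). *)
Record sections (U : opens proj_point) := Sections {
  sec_val :> forall p, oset U p -> loc (away p) M;
  sec_val_part : forall p Up, loc_part gM (away p) 0 (@sec_val p Up);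
  sec_val_loc : locally_fraction sec_val }.
Arguments sec_val {U} s p Up.

Lemma sectionsP U (s t : sections U) :
  (forall p Up, s p Up = t p Up) -> s = t.
Proof.
case: s t => [s s1 s2] [t t1 t2] /= st.
have {}st : s = t by apply: functional_extensionality_dep => p; apply/funext.
by subst t; congr Sections; exact: Prop_irrelevance.
Qed.

HB.instance Definition _ U := gen_eqMixin (sections U).
HB.instance Definition _ U := gen_choiceMixin (sections U).

Lemma sec_irr U (s : sections U) p (Up Up' : oset U p) : s p Up = s p Up'.
Proof. by rewrite (Prop_irrelevance Up Up'). Qed.

Lemma opens_setI (U V : opens proj_point) : open (U `&` V).
Proof. exact: openI (osetP U) (osetP V). Qed.

Lemma loc_part0 (S : mulrClosed A) e : loc_part gM S e 0.
Proof.
exists 0, 0, 1, (rpred1 S); split; last by rewrite frac0.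
  by have [] := gpart_zmod gM (0 + e).
exact: gring1.
Qed.

Lemma loc_partN (S : mulrClosed A) e x :
  loc_part gM S e x -> loc_part gM S e (- x).
Proof.
move=> [d [m [s [sS [mG sG ->]]]]]; exists d, (- m), s, sS.
split; rewrite ?fracN //.
by have /GRing.zmod_closedN := gpart_zmod gM (d + e); apply.
Qed.

Lemma loc_partD (S : mulrClosed A) e x y :
  loc_part gM S e x -> loc_part gM S e y -> loc_part gM S e (x + y).
Proof.
move=> [d [m [s [sS [mG sG ->]]]]] [d' [m' [s' [sS' [mG' sG' ->]]]]].
exists (d + d'), (s' *: m + s *: m'), (s * s'), (rpredM sS sS').
split; [| exact: gringM | exact: fracD].
have /GRing.zmod_closedD[_ clD] := gpart_zmod gM (d + d' + e).
apply: clD.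
  by have := gmodZ sG' mG; rewrite addrA [d' + d]addrC.
by have := gmodZ sG mG'; rewrite addrA.
Qed.

Lemma loc_partZ (S : mulrClosed A) e x y :
  loc_part (regular_module gA) S 0 x -> loc_part gM S e y ->
  loc_part gM S e (x *: y).
Proof.
move=> [d [a [s [sS [aG sG ->]]]]] [d' [m [s' [sS' [mG sG' ->]]]]].
exists (d + d'), ((a : A) *: m), (s * s'), (rpredM sS sS').
split; [| exact: gringM | exact: fracZ].
by have := gmodZ aG mG; rewrite addr0 addrA.
Qed.

Variable U : opens proj_point.
Implicit Types s t : sections U.

Lemma sec_zero_loc :
  locally_fraction (fun p (_ : oset U p) => 0 : loc (away p) M).
Proof.
move=> p Up; exists U; split=> //; exists (@subset_refl _ U), 0, 1 => q Uq.
by exists (rpred1 _); rewrite frac0.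
Qed.

Definition sec_zero : sections U :=
  Sections (fun p _ => loc_part0 (away p) 0) sec_zero_loc.

Lemma sec_opp_loc s : locally_fraction (fun p (Up : oset U p) => - s p Up).
Proof.
move=> p /(sec_val_loc s)[V [Vp [hV [m [a sE]]]]].
exists V; split=> //; exists hV, (- m), a => q Vq.
by have [aq ->] := sE q Vq; exists aq; rewrite fracN.
Qed.

Definition sec_opp s : sections U :=
  Sections (fun p Up => loc_partN (sec_val_part s Up)) (@sec_opp_loc s).

Lemma sec_add_loc s t :
  locally_fraction (fun p (Up : oset U p) => s p Up + t p Up).
Proof.
move=> p Up; have [V [Vp [hV [m [a sE]]]]] := sec_val_loc s Up.
have [W [Wp [hW [n [b tE]]]]] := sec_val_loc t Up.
exists (Opens (opens_setI V W)); split=> //.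
exists (fun q VWq => hV q (proj1 VWq)), (b *: m + a *: n), (a * b) => q [Vq Wq].
have [aq sq] := sE q Vq; have [bq tq] := tE q Wq.
exists (rpredM aq bq); rewrite -fracD -sq -tq /=.
by congr (_ + _); exact: sec_irr.
Qed.

Definition sec_add s t : sections U :=
  Sections (fun p Up => loc_partD (sec_val_part s Up) (sec_val_part t Up))
    (@sec_add_loc s t).

Lemma sec_addA : associative sec_add.
Proof. by move=> s t u; apply: sectionsP => p Up; exact: addrA. Qed.
Lemma sec_addC : commutative sec_add.
Proof. by move=> s t; apply: sectionsP => p Up; exact: addrC. Qed.
Lemma sec_add0 : left_id sec_zero sec_add.
Proof. by move=> s; apply: sectionsP => p Up; exact: add0r. Qed.
Lemma sec_addN : left_inverse sec_zero sec_opp sec_add.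
Proof. by move=> s; apply: sectionsP => p Up; exact: addNr. Qed.

HB.instance Definition _ :=
  GRing.isZmodule.Build (sections U) sec_addA sec_addC sec_add0 sec_addN.

End Sections.

Section SectionsScale.
Variables (M : lmodType A) (gM : graded_module gA M) (U : opens proj_point).
Local Notation secR := (sections (regular_module gA) U).

Lemma sec_scale_loc (s : secR) (t : sections gM U) :
  locally_fraction (fun p (Up : oset U p) => s p Up *: t p Up).
Proof.
move=> p Up; have [V [Vp [hV [a [b sE]]]]] := sec_val_loc s Up.
have [W [Wp [hW [m [c tE]]]]] := sec_val_loc t Up.
exists (Opens (opens_setI V W)); split=> //.
exists (fun q VWq => hV q (proj1 VWq)), ((a : A) *: m), (b * c) => q [Vq Wq].
have [bq sq] := sE q Vq; have [cq tq] := tE q Wq.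
exists (rpredM bq cq); rewrite -fracZ -sq -tq /=.
by congr (_ *: _); exact: sec_irr.
Qed.

Definition sec_scale (s : secR) (t : sections gM U) : sections gM U :=
  Sections (fun p Up => loc_partZ (sec_val_part s Up) (sec_val_part t Up))
    (@sec_scale_loc s t).

End SectionsScale.

Section SectionsRing.
Variable U : opens proj_point.
Local Notation secR := (sections (regular_module gA) U).

Lemma loc_part1 (S : mulrClosed A) : loc_part (regular_module gA) S 0 1.
Proof.
exists 0, 1, 1, (rpred1 S); split=> //; first by rewrite addr0; exact: gring1.
exact: gring1.
Qed.

Lemma sec_one_loc :
  locally_fraction (fun p (_ : oset U p) => 1 : loc (away p) A^o).
Proof.
move=> p Up; exists U; split=> //; exists (@subset_refl _ U), 1, 1 => q Uq.
by exists (rpred1 _).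
Qed.

Definition sec_one : secR :=
  Sections (fun p _ => loc_part1 (away p)) sec_one_loc.

Definition sec_mul : secR -> secR -> secR :=
  @sec_scale A^o (regular_module gA) U.

Lemma sec_mulA : associative sec_mul.
Proof. by move=> s t u; apply: sectionsP => p Up; exact: mulrA. Qed.
Lemma sec_mulC : commutative sec_mul.
Proof. by move=> s t; apply: sectionsP => p Up; exact: mulrC. Qed.
Lemma sec_mul1 : left_id sec_one sec_mul.
Proof. by move=> s; apply: sectionsP => p Up; exact: mul1r. Qed.
Lemma sec_mulD : left_distributive sec_mul +%R.
Proof. by move=> s t u; apply: sectionsP => p Up; exact: mulrDl. Qed.

HB.instance Definition _ := GRing.Zmodule_isComPzRing.Build secR
  sec_mulA sec_mulC sec_mul1 sec_mulD.

Variables (M : lmodType A) (gM : graded_module gA M).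

Lemma sec_scaleA (s t : secR) (u : sections gM U) :
  sec_scale s (sec_scale t u) = sec_scale (s * t) u.
Proof. by apply: sectionsP => p Up; exact: scalerA. Qed.
Lemma sec_scale1 : left_id (1 : secR) (@sec_scale M gM U).
Proof. by move=> s; apply: sectionsP => p Up; exact: scale1r. Qed.
Lemma sec_scaleDr : right_distributive (@sec_scale M gM U) +%R.
Proof. by move=> s t u; apply: sectionsP => p Up; exact: scalerDr. Qed.
Lemma sec_scaleDl (u : sections gM U) :
  {morph (@sec_scale M gM U)^~ u : s t / s + t}.
Proof. by move=> s t; apply: sectionsP => p Up; exact: scalerDl. Qed.

HB.instance Definition _ := GRing.Zmodule_isLmodule.Build secR (sections gM U)
  sec_scaleA sec_scale1 sec_scaleDr sec_scaleDl.

End SectionsRing.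

Section Restriction.
Variables (M : lmodType A) (gM : graded_module gA M).

Lemma sec_res_loc (U V : opens proj_point) (h : V `<=` U) (s : sections gM U) :
  locally_fraction (fun p (Vp : oset V p) => s p (h p Vp)).
Proof.
move=> p Vp; have [W [Wp [hW [m [a sE]]]]] := sec_val_loc s (h p Vp).
exists (Opens (opens_setI V W)); split=> //.
exists (fun q VWq => proj1 VWq), m, a => q [Vq Wq].
by have [aq sq] := sE q Wq; exists aq; rewrite -sq; exact: sec_irr.
Qed.

Definition sec_res (U V : opens proj_point) (h : V `<=` U) (s : sections gM U) :
    sections gM V :=
  Sections (fun p Vp => sec_val_part s (h p Vp)) (@sec_res_loc U V h s).

Lemma sec_res_sheaf : is_sheaf sec_res.
Proof.
split=> [U h s|U V W hVU hWV hWU s|I U V hV UV s t st|I U V hV UV s scompat].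
- by apply: sectionsP => p Up; exact: (sec_irr s).
- by apply: sectionsP => p Up; exact: (sec_irr s).
- apply: sectionsP => p Up; have [i _ Vp] := UV p Up.
  have /(congr1 (fun u : sections gM (V i) => u p Vp)) /= := st i.
  by rewrite (sec_irr s _ Up) (sec_irr t _ Up).
have ch p (Up : oset U p) : {i | oset (V i) p}.
  by apply: cid; have [i _ Vp] := UV p Up; exists i.
pose t p (Up : oset U p) := s (sval (ch p Up)) p (svalP (ch p Up)).
have tE p (Up : oset U p) i (Vp : oset (V i) p) : t p Up = s i p Vp.
  rewrite /t; case: (ch p Up) => j Vjp /=.
  pose W := Opens (opens_setI (V j) (V i)).
  have := scompat j i W (fun q Wq => proj1 Wq) (fun q Wq => proj2 Wq).
  move/(congr1 (fun u : sections gM W => u p (conj Vjp Vp))) => /= e.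
  by rewrite (sec_irr (s j) _ (proj1 (conj Vjp Vp))) e; exact: sec_irr.
have tpart p Up : loc_part gM (away p) 0 (t p Up) by exact: sec_val_part.
have tloc : locally_fraction t.
  move=> p Up; have [i _ Vp] := UV p Up.
  have [W [Wp [hW [m [a sE]]]]] := sec_val_loc (s i) Vp.
  exists W; split=> //; exists (subset_trans hW (hV i)), m, a => q Wq.
  by have [aq sq] := sE q Wq; exists aq; rewrite -sq; exact: tE.
by exists (Sections tpart tloc) => i; apply: sectionsP => p Vp; exact: tE.
Qed.

End Restriction.

Section RestrictionRing.
Variables (U V : opens proj_point) (h : V `<=` U).

Definition sec_res_ring :
    sections (regular_module gA) U -> sections (regular_module gA) V :=
  sec_res h.

Lemma sec_res_zmod : zmod_morphism sec_res_ring.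
Proof. by move=> s t; apply: sectionsP. Qed.
Lemma sec_res_monoid : monoid_morphism sec_res_ring.
Proof. by split=> [|s t]; apply: sectionsP. Qed.

HB.instance Definition _ := GRing.isZmodMorphism.Build _ _ sec_res_ring
  sec_res_zmod.
HB.instance Definition _ := GRing.isMonoidMorphism.Build _ _ sec_res_ring
  sec_res_monoid.

End RestrictionRing.

Definition ProjMH : ringed_space :=
  @RingedSpace proj_point (fun U => sections (regular_module gA) U)
    (fun U V h => @sec_res_ring U V h) (sec_res_sheaf (regular_module gA)).

Section Tilde.
Variables (M : lmodType A) (gM : graded_module gA M).

Lemma sec_res_linear (U V : opens proj_point) (h : V `<=` U)
    (a : sections (regular_module gA) U) (s t : sections gM U) :
  sec_res h (a *: s + t) = sec_res_ring h a *: sec_res h s + sec_res h t.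
Proof. exact: sectionsP. Qed.

Definition tilde : sheaf_of_modules ProjMH :=
  @SheafOfModules ProjMH (fun U => sections gM U) (@sec_res M gM)
    sec_res_linear (sec_res_sheaf gM).

End Tilde.

(* Written O_X(d). *)
Definition twist (d : D) : sheaf_of_modules ProjMH :=
  tilde (shift_module (regular_module gA) d).

End ProjMH.

(* Main.v *)
(* On D_+(f), with f relevant, every homogeneous divisor of a power of f lies
   outside all the ideals I_p.  Hence the degrees of the fractions u / v of
   homogeneous elements that are invertible along D_+(f) form a subgroup of D
   containing D_f, so some such fraction has degree d; multiplication by u / v is
   an isomorphism from O_X to O_X(d) on D_+(f), with inverse v / u. *)

Require Import Defs.
From mathcomp Require Import all_boot all_order all_algebra.
From mathcomp Require Import all_classical topology.

Set Implicit Arguments.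
Unset Strict Implicit.
Unset Printing Implicit Defensive.

Import GRing.Theory.
Local Open Scope ring_scope.

Lemma Dplus_open (D : zmodType) (A : comNzRingType) (gA : graded_ring D A)
    (f : A) : relevant gA f -> open (Dplus (gA := gA) f).
Proof.
move=> frel; exists [set Dplus (gA := gA) f]%classic; last exact: bigcup_set1.
by move=> _ ->; apply: finI_from1; exists f.
Qed.

Lemma pideal_mulr (D : zmodType) (A : comNzRingType) (gA : graded_ring D A)
    (p : proj_point gA) (a b : A) : a \in pideal p -> a * b \in pideal p.
Proof.
have [p0 _ pD] := pideal_ideal p.
by move=> ap; have := pD b a 0 ap p0; rewrite addr0 mulrC.
Qed.

(** An ideal containing [a] would contain the multiple [f ^+ N], whereas the multiplicatively closed
    set [away p] contains all powers of [f]. *)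
Lemma power_divisor_away (D : zmodType) (A : comNzRingType)
    (gA : graded_ring D A) (p : proj_point gA) (f a b : A) (N : nat) :
  f \in away p -> a \in homogeneous gA -> f ^+ N = a * b -> a \in away p.
Proof.
move=> fp ha fE; apply/andP; split=> //; apply/negP => ap.
have := pideal_mulr b ap; rewrite -fE; apply/negP.
by have /andP[] : f ^+ N \in away p by exact: rpredX.
Qed.

(** [degree_group] is an intersection of subgroups, so it is enough to instantiate it at the set [H]
    of degrees of such fractions. The pair [u], [v] is chosen before [p], so one fraction serves all
    of [Dplus f]. *)
Lemma degree_group_fraction (D : zmodType) (A : comNzRingType)
    (gA : graded_ring D A) (f : A) (d : D) :
  f \in homogeneous gA -> degree_group gA f d ->
  exists e (u v : A), [/\ u \in gA (d + e), v \in gA e &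
    forall p : proj_point gA, Dplus f p -> u \in away p /\ v \in away p].
Proof.
move=> hf dP; pose H : {pred D} := [pred d | `[< exists e (u v : A),
  [/\ u \in gA (d + e), v \in gA e &
    forall p : proj_point gA, Dplus f p -> u \in away p /\ v \in away p] >]].
apply/asboolP; apply: (dP H) => [|e [a [_ ae [N [b [_ fE]]]]]].
  split=> [|d1 d2 /asboolP[e1 [u1 [v1 [u1e v1e uv1]]]]
      /asboolP[e2 [u2 [v2 [u2e v2e uv2]]]]]; apply/asboolP.
    exists 0, 1, 1; rewrite addr0; split=> [||p _]; try exact: gring1.
    by split; exact: rpred1.
  (* Closure under subtraction comes from the quotient of [u1 / v1] by [u2 / v2]. *)
  exists (e1 + (d2 + e2)), (u1 * v2), (v1 * u2).
  split=> [||p fp]; last 1 first.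
  - have [? ?] := uv1 p fp; have [? ?] := uv2 p fp.
    by split; exact: rpredM.
  - have -> : d1 - d2 + (e1 + (d2 + e2)) = d1 + e1 + e2.
      by rewrite addrCA [X in e1 + X]addrA subrK addrCA addrA.
    exact: gringM.
  - exact: gringM.
(* A generating degree is realised by the fraction [a / 1]. *)
apply/asboolP; exists 0, a, 1; rewrite addr0; split=> // [|p fp].
  exact: gring1.
split; last exact: rpred1.
apply: power_divisor_away fE; first by apply/andP.
by apply/asboolP; exists e.
Qed.

Section SectionsFraction.
Variables (D : zmodType) (A : comNzRingType) (gA : graded_ring D A).
Variables (M : lmodType A) (gM gN : graded_module gA M).
Variables (u v : A) (e : D).
Hypothesis v_deg : v \in gA e.
Hypothesis u_shift : forall c m, m \in gM c -> u *: m \in gN (e + c).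
Variable U : opens (proj_point gA).
Hypothesis v_away : forall p, oset U p -> v \in away p.

(** Passing from [gM] to [gN], multiplication by [u] raises degrees by [e], and division by [v]
    lowers them by [e]. *)
Lemma sec_frac_part (s : sections gM U) p (Up : oset U p) :
  loc_part gN (away p) 0
    (loc_frac (u : A^o) (v_away Up) *: (s p Up : loc (away p) M)).
Proof.
have [d [m [a [aS [mG aG ->]]]]] := sec_val_part s Up.
exists (e + d), (u *: m), (v * a), (rpredM (v_away Up) aS).
split; [by rewrite -addrA; exact: u_shift | exact: gringM | exact: fracZ].
Qed.

Lemma sec_frac_loc (s : sections gM U) :
  locally_fraction (fun p (Up : oset U p) =>
    loc_frac (u : A^o) (v_away Up) *: (s p Up : loc (away p) M)).
Proof.
move=> p Up; have [V [Vp [hV [m [a sE]]]]] := sec_val_loc s Up.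
exists V; split=> //; exists hV, (u *: m), (v * a) => q Vq.
have [aq ->] := sE q Vq; exists (rpredM (v_away (hV q Vq)) aq).
exact: fracZ.
Qed.

(** Both gradings live on the same module [M], so multiplication by [u / v] and its inverse [v / u]
    are instances of one construction. *)
Definition sec_frac (s : sections gM U) : sections gN U :=
  Sections (sec_frac_part s) (sec_frac_loc s).

End SectionsFraction.

Lemma sec_fracK (D : zmodType) (A : comNzRingType) (gA : graded_ring D A)
    (M : lmodType A) (gM gN : graded_module gA M) (u v : A) (e e' : D)
    (v_deg : v \in gA e)
    (u_shift : forall c m, m \in gM c -> u *: m \in gN (e + c))
    (u_deg : u \in gA e')
    (v_shift : forall c m, m \in gN c -> v *: m \in gM (e' + c))
    (U : opens (proj_point gA))
    (v_away : forall p, oset U p -> v \in away p)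
    (u_away : forall p, oset U p -> u \in away p) :
  cancel (sec_frac v_deg u_shift v_away) (sec_frac u_deg v_shift u_away).
Proof.
move=> s; apply: sectionsP => p Up /=.
rewrite scalerA fracM [X in X *: _](_ : _ = 1) ?scale1r //.
apply/frac_eq; exists 1; first exact: rpred1.
(* The unit is the fraction [1 / 1] and scaling on [A^o] is multiplication, so this is the
   cross-multiplied equality. *)
by change (1 * 1 * (v * u) = 1 * (u * v) * 1); rewrite !mul1r mulr1 mulrC.
Qed.

Theorem theorem3p9 (D : zmodType) (A : idomainType) (gA : graded_ring D A)
    (r : nat) (x : 'I_r -> A) (d : D)
    (D_free : free_fg D)
    (x_homogeneous : forall i, x i \in homogeneous gA)
    (x_generate : forall B : {pred A}, subring_closed B ->
       (forall a : A, a \in gA 0 -> a \in B) -> (forall i, x i \in B) ->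
       forall a, a \in B)
    (A0_field : forall a : A, a \in gA 0 -> a != 0 ->
       exists2 b : A, b \in gA 0 & a * b = 1)
    (A_units : forall a : A, a \is a GRing.unit <->
       a \in gA 0 /\ exists2 b : A, b \in gA 0 & a * b = 1)
    (d_in_all : forall f : A, relevant gA f -> degree_group gA f d) :
  line_bundle (twist gA d).
Proof.
move=> p; have [f frel fp] := pideal_relevant p.
have [e [u [v [ud vd uv]]]] :=
  degree_group_fraction (proj1 frel) (d_in_all f frel).
exists (Opens (Dplus_open frel)); split=> //.
(* Degree [e + c] in the shifted module is degree [e + c + d] in [A], which is the degree of
   [u * m]. *)
have u_shift c (m : A^o) : m \in regular_module gA c ->
    u *: m \in shift_module (regular_module gA) d (e + c).
  by move=> mc; have := gringM ud mc; rewrite -addrA addrC.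
have v_shift c (m : A^o) : m \in shift_module (regular_module gA) d c ->
    v *: m \in regular_module gA (d + e + c).
  by move=> mc; have := gringM vd mc; rewrite addrC -addrA addrC.
have u_away (V : opens (proj_point gA)) : (V `<=` Dplus f)%classic ->
    forall q, oset V q -> u \in away q.
  by move=> hV q /hV/uv[].
have v_away (V : opens (proj_point gA)) : (V `<=` Dplus f)%classic ->
    forall q, oset V q -> v \in away q.
  by move=> hV q /hV/uv[].
exists (fun V hV => sec_frac vd u_shift (v_away V hV)); split.
- move=> V hV a s t; apply: sectionsP => q Vq.
  rewrite /= scalerDr; congr (_ + _).
  by rewrite !scalerA [X in X *: _]mulrC.
(* The hypotheses of [sec_fracK] are symmetric in [u] and [v], so it yields both composites. *)
- move=> V hV; exists (sec_frac ud v_shift (u_away V hV)); exact: sec_fracK.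
- move=> V W hV hW h s; apply: sectionsP => q Wq /=.
  (* The two fractions [u / v] differ only in the proof that [v] lies in [away q]. *)
  by congr (_ *: _); exact: frac_congr.
Qed.
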